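(* Let $d$ be a real number and let $Z$ be a complex random variable with $\operatorname{diam} Z\le d$. Then \[ \bigl|\mathbb{E}\, e^{Z-\mathbb{E} Z}-1\bigr| \le e^{d^2/8}-1. \]
   Context: For a complex random variable $Z$, the diameter of $Z$ is \[ \operatorname{diam} Z = \inf\,\{ c\in\mathbb{R} : P(|Z_1-Z_2|>c)=0\}, \] where $Z_1,Z_2$ are independent copies of $Z$, and the infimum of the empty set is taken to be $\infty$. *)

(* Defs.v *)
From HB Require Import structures.
From mathcomp Require Import all_boot all_order all_algebra.
From mathcomp Require Import all_classical all_reals all_analysis.
From mathcomp Require Import complex.

Set Implicit Arguments.
Unset Strict Implicit.
Unset Printing Implicit Defensive.

Import Order.TTheory GRing.Theory Num.Theory.
Import numFieldNormedType.Exports.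

Local Open Scope classical_set_scope.
Local Open Scope complex_scope.
Local Open Scope ring_scope.

Definition cexp (R : realType) (z : R[i]) : R[i] :=
  (expR (complex.Re z))%:C * (cos (complex.Im z) +i* sin (complex.Im z)).

Definition complex_random_variable (disp : measure_display)
    (T : measurableType disp) (R : realType) (Z : T -> R[i]) : Prop :=
  measurable_fun [set: T] (fun w => complex.Re (Z w)) /\
  measurable_fun [set: T] (fun w => complex.Im (Z w)).

(* Meaningful when the real and imaginary parts of Z are integrable, which is
   automatic for random variables that are almost surely bounded. *)
Definition cexpectation (disp : measure_display) (T : measurableType disp)
    (R : realType) (P : probability T R) (Z : T -> R[i]) : R[i] :=
  fine 'E_P[fun w => complex.Re (Z w)] +i* fine 'E_P[fun w => complex.Im (Z w)].

(* The independent copies Z1, Z2 of Z are realized as the two coordinates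
   Z w.1, Z w.2 on the product space (T * T, P \x P); see copies_independent
   (taking B or A to be setT gives the marginals). On R[i] the order satisfies
   c%:C < `|z| exactly when c < |z| as real numbers. *)
Definition diam (disp : measure_display) (T : measurableType disp)
    (R : realType) (P : probability T R) (Z : T -> R[i]) : \bar R :=
  ereal_inf [set c%:E | c in
    [set c : R | (P \x P)%E [set w : T * T | c%:C < `|Z w.1 - Z w.2|] = 0%E]].

Lemma copies_independent (disp : measure_display) (T : measurableType disp)
    (R : realType) (P : probability T R) (Z : T -> R[i]) (A B : set R[i]) :
  measurable (Z @^-1` A) -> measurable (Z @^-1` B) ->
  ((P \x P) [set w : T * T | A (Z w.1) /\ B (Z w.2)] =
   P (Z @^-1` A) * P (Z @^-1` B))%E.
Proof. by move=> mA mB; rewrite -product_measure1E. Qed.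

(* Main.v *)
Require Import Defs.
From mathcomp Require Import all_boot all_order all_algebra.
From mathcomp Require Import all_classical all_reals all_analysis.
From mathcomp Require Import measurable_realfun.
From mathcomp Require Import complex.
From mathcomp Require Import ring lra.

Import Order.TTheory GRing.Theory Num.Theory.
Import numFieldNormedType.Exports.

Local Open Scope classical_set_scope.
Local Open Scope complex_scope.
Local Open Scope ring_scope.

Set Implicit Arguments.
Unset Strict Implicit.
Unset Printing Implicit Defensive.

(** Let W = Z - E Z and let W' be an independent copy of W, so that
    |W - W'| <= d almost surely. Put T = E |W|^2, m = |E W^2| and
    M = E |W|^4.
    - Averaging |W - W'|^2 <= d^2 over W' gives |W| <= d almost surely.
    - Expanding E |W - W'|^2 (d^2 - |W - W'|^2) >= 0 gives
      M <= d^2 T - 2 T^2 - m^2.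
    - Since E W^3 = E W (W^2 - E W^2), AM-GM gives
      2 |E W^3| <= k T + (M - m^2) / k for every k > 0; take k = d^2 / 6.
    - The tail of the exponential series after the cubic term is at most
      |W|^4 (e^d - 1 - d - d^2/2 - d^3/6) / d^4.
    Together these bound |E e^W - 1| by a concave quadratic function of m and
    T, whose maximum is compared with e^(d^2/8) - 1. *)

(** * Bounds on the real exponential *)

Lemma le_of_eq (R : realType) (x y : R) : x = y -> x <= y.
Proof. by move->. Qed.

Lemma le_of_derive_ge0 (R : realType) (f df : R -> R) (b : R) : 0 <= b ->
  (forall x : R, is_derive x (1 : R) f (df x)) ->
  (forall x, 0 <= x -> x <= b -> 0 <= df x) -> f 0 <= f b.
Proof.
move=> b0 fdf df0.
have cf : {within `[0, b], continuous f}.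
  apply: continuous_subspaceT => x.
  by apply/differentiable_continuous/derivable1_diffP; apply: ex_derive.
have [c + fE] := MVT_segment b0 (fun x _ => fdf x) cf.
rewrite in_itv/= => /andP[c0 cb]; rewrite -subr_ge0 fE.
by rewrite mulr_ge0// ?subr0//; exact: df0.
Qed.

(* In this context the notation [p^`()] is the analytic derivative, whence
   [deriv p] for the formal one. *)
Lemma expR_le_horner (R : realType) (p : {poly R}) (b x : R) :
  (forall t, 0 <= t -> t <= b -> p.[t] <= (deriv p).[t]) -> 1 <= p.[0] ->
  0 <= x -> x <= b -> expR x <= p.[x].
Proof.
move=> pp p0 x0 xb.
(* The derivative of e^(-t) p(t) is e^(-t) (p'(t) - p(t)), so the product is nondecreasing on
   [0, x]. *)
have : expR (- 0) * p.[0] <= expR (- x) * p.[x].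
  apply: (@le_of_derive_ge0 R (fun t => expR (- t) * p.[t])
    (fun t => expR (- t) * ((deriv p).[t] - p.[t]))) => // t.
    apply: is_derive_eq.
    rewrite /GRing.scale/=; ring.
  by move=> t0 tx; rewrite mulr_ge0 ?expR_ge0// subr_ge0 pp// (le_trans tx).
rewrite oppr0 expR0 mul1r expRN => /(le_trans p0).
by rewrite ler_pdivlMl ?expR_gt0// mulr1.
Qed.

Lemma expR_ge_horner (R : realType) (p : {poly R}) (x : R) :
  (forall t, 0 <= t -> (deriv p).[t] <= p.[t]) -> p.[0] <= 1 ->
  0 <= x -> p.[x] <= expR x.
Proof.
move=> pp p0 x0.
have : - (expR (- 0) * p.[0]) <= - (expR (- x) * p.[x]).
  apply: (@le_of_derive_ge0 R (fun t => - (expR (- t) * p.[t]))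
    (fun t => expR (- t) * (p.[t] - (deriv p).[t]))) => // t.
    apply: is_derive_eq.
    rewrite /GRing.scale/=; ring.
  by move=> t0 tx; rewrite mulr_ge0 ?expR_ge0// subr_ge0 pp.
rewrite lerN2 oppr0 expR0 mul1r expRN => /le_trans/(_ p0).
by rewrite ler_pdivrMl ?expR_gt0// mulr1.
Qed.

(** The Taylor polynomial exceeds its derivative by its leading term x^7 / 7!, which is
    nonnegative. *)
Lemma expR_taylor7_le (R : realType) (x : R) : 0 <= x ->
  1 + x * (1 + x / 2 * (1 + x / 3 * (1 + x / 4 * (1 + x / 5 * (1 + x / 6 *
    (1 + x / 7)))))) <= expR x.
Proof.
move=> x0.
pose p : {poly R} := 1 + 'X * (1 + 2^-1 *: 'X * (1 + 3^-1 *: 'X *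
  (1 + 4^-1 *: 'X * (1 + 5^-1 *: 'X * (1 + 6^-1 *: 'X * (1 + 7^-1 *: 'X)))))).
have pE t : p.[t] = 1 + t * (1 + t / 2 * (1 + t / 3 * (1 + t / 4 *
    (1 + t / 5 * (1 + t / 6 * (1 + t / 7)))))).
  by rewrite /p !hornerE /=; field.
have dpE t : (deriv p).[t] = p.[t] - t ^+ 7 / 2 / 3 / 4 / 5 / 6 / 7.
  by rewrite /p !poly.derivE !hornerE /=; field.
rewrite -pE; apply: expR_ge_horner => //; last by rewrite pE mul0r addr0.
by move=> t t0; rewrite dpE gerBl !divr_ge0// exprn_ge0.
Qed.

Lemma expR_taylor5_le (R : realType) (x : R) : 0 <= x ->
  1 + x * (1 + x / 2 * (1 + x / 3 * (1 + x / 4 * (1 + x / 5)))) <= expR x.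
Proof.
move=> x0; have := expR_taylor7_le x0.
have : 0 <= x ^+ 6 by rewrite exprn_ge0.
have : 0 <= x ^+ 7 by rewrite exprn_ge0.
lra.
Qed.

(* Taking 1 / (8! * 5) instead of 1 / 9! as last coefficient makes the polynomial
   smaller than its derivative on [0, 4]. *)
Lemma expR_le_taylor9 (R : realType) (x : R) : 0 <= x -> x <= 4 ->
  expR x <= 1 + x * (1 + x / 2 * (1 + x / 3 * (1 + x / 4 * (1 + x / 5 *
    (1 + x / 6 * (1 + x / 7 * (1 + x / 8 * (1 + x / 5)))))))).
Proof.
move=> x0 x4.
pose p : {poly R} := 1 + 'X * (1 + 2^-1 *: 'X * (1 + 3^-1 *: 'X *
  (1 + 4^-1 *: 'X * (1 + 5^-1 *: 'X * (1 + 6^-1 *: 'X * (1 + 7^-1 *: 'X *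
  (1 + 8^-1 *: 'X * (1 + 5^-1 *: 'X)))))))).
have pE t : p.[t] = 1 + t * (1 + t / 2 * (1 + t / 3 * (1 + t / 4 * (1 + t / 5 *
    (1 + t / 6 * (1 + t / 7 * (1 + t / 8 * (1 + t / 5)))))))).
  by rewrite /p !hornerE /=; field.
have dpE t : (deriv p).[t] = p.[t] + t ^+ 8 * (4 - t) / 2 / 3 / 4 / 5 / 6 / 7 / 8 / 5.
  by rewrite /p !poly.derivE !hornerE /=; field.
rewrite -pE; apply: (@expR_le_horner _ p 4) => //; last by rewrite pE mul0r addr0.
move=> t t0 t4; rewrite dpE lerDl !divr_ge0// mulr_ge0 ?exprn_ge0//.
by rewrite subr_ge0.
Qed.

(** * Maximum of the quadratic moment function *)

(** The function y / (1 + y) is concave with tangent (y + a^2) / (1 + a)^2 at y = a; this comparison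
    is multiplied by y. *)
Lemma sqr_div1D_le_tangent (R : realType) (y a : R) : 0 <= y -> 0 <= a ->
  y ^+ 2 / (1 + y) <= y * (y + a ^+ 2) / (1 + a) ^+ 2.
Proof.
move=> y0 a0.
have y1 : 0 < 1 + y by rewrite ltr_pwDl.
have a1 : 0 < (1 + a) ^+ 2 by rewrite exprn_gt0// ltr_pwDl.
rewrite ler_pdivrMr// mulrAC ler_pdivlMr//.
rewrite -subr_ge0; have -> : y * (y + a ^+ 2) * (1 + y) - y ^+ 2 * (1 + a) ^+ 2
  = y * (y - a) ^+ 2 by ring.
by rewrite mulr_ge0// sqr_ge0.
Qed.

(* Here y stands for [exp_rem4 d / d ^+ 2]. On a short interval it is bounded by
   d^2 times the chord k0 + k1 d of a convex polynomial, and y^2 / (1 + y) by its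
   tangent at y = a, so that only a polynomial inequality in d is left. Large
   constants are written as iterated divisions because numerals are unary. *)
Lemma growth_bound_of_chord (R : realType) (c k0 k1 a d y : R) :
  0 <= c -> 0 <= a -> 0 <= d -> 0 <= y ->
  1 <= c * (1 + 2 * y) -> y <= d ^+ 2 * (k0 + k1 * d) ->
  (k0 + k1 * d) * (1 + a ^+ 2 / (1 + a) ^+ 2)
    + d ^+ 2 * (k0 + k1 * d) ^+ 2 / (1 + a) ^+ 2 + c * d ^+ 2 / 36 / 36
    <= 5 / 72 + d ^+ 2 / 192 + d ^+ 4 / 64 / 96 + d ^+ 6 / 64 / 64 / 60 ->
  y + y ^+ 2 / (1 + y) + d ^+ 4 / (36 * 36 * (1 + 2 * y)) <=
    d ^+ 2 * (5 / 72 + d ^+ 2 / 192 + d ^+ 4 / 64 / 96 + d ^+ 6 / 64 / 64 / 60).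
Proof.
move=> c0 a0 d0 y0 cy yK H.
apply: le_trans (ler_wpM2l (sqr_ge0 d) H).
set K := k0 + k1 * d in yK *; set s := ((1 + a) ^+ 2)^-1.
have s0 : 0 <= s by rewrite invr_ge0 sqr_ge0.
have h1 : y ^+ 2 / (1 + y) <= y * (y + a ^+ 2) * s := sqr_div1D_le_tangent y0 a0.
(* The hypothesis on [c] makes it an upper bound of 1 / (1 + 2 y). *)
have h2 : d ^+ 4 / (36 * 36 * (1 + 2 * y)) <= c * d ^+ 4 / 36 / 36.
  rewrite invfM mulrA invfM mulrA (mulrAC _ (_^-1) (1 + 2 * y)^-1).
  rewrite (mulrAC _ (_^-1) (1 + 2 * y)^-1) !ler_wpM2r// ler_pdivrMr; last lra.
  by rewrite mulrAC ler_peMl// exprn_ge0.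
have h3 : y * (y + a ^+ 2) * s <= d ^+ 2 * K * (d ^+ 2 * K + a ^+ 2) * s.
  by rewrite ler_wpM2r// ler_pM// ?addr_ge0 ?sqr_ge0// lerD2r.
apply: le_trans (lerD (lerD yK (le_trans h1 h3)) h2) _.
have e : d ^+ 2 * K + d ^+ 2 * K * (d ^+ 2 * K + a ^+ 2) * s + c * d ^+ 4 / 36 / 36
  = d ^+ 2 * (K * (1 + a ^+ 2 * s) + d ^+ 2 * K ^+ 2 * s + c * d ^+ 2 / 36 / 36).
  by ring.
by rewrite e.
Qed.

(** To put a polynomial of degree 5 below a line on [l, h], their difference is sought as a
    nonnegative combination of the products d^i (d - l) (h - d) and of the constraints on d. *)
Ltac chord_lra ch :=
  have := ch 0%N; have := ch 1%N; have := ch 2%N; have := ch 3%N; lra.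

(** A polynomial of degree at most 6 is nonnegative on [l, h] as soon as its coefficients in the
    Bernstein products (d - l)^i (h - d)^(6 - i) are. *)
Ltac bernstein_lra bn :=
  have := bn 0%N 6%N; have := bn 1%N 5%N; have := bn 2%N 4%N; have := bn 3%N 3%N;
  have := bn 4%N 2%N; have := bn 5%N 1%N; have := bn 6%N 0%N; lra.

(** Adding 2 + d^2 / 18 to the right side and multiplying by d^2 / 16 gives the degree 5 Taylor
    polynomial of e^v - 1 at v = d^2 / 8. The interval [0, 4] is cut at 2, 5/2, 3 and 7/2, each
    piece having its own chord and tangent point. *)
Lemma growth_bound_small (R : realType) (d y : R) : 0 <= d -> d <= 4 ->
  d ^+ 2 / 24 * (1 + d / 5 * (1 + d / 6)) <= y ->
  y <= d ^+ 2 / 24 * (1 + d / 5 * (1 + d / 6 * (1 + d / 7 *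
    (1 + d / 8 * (1 + d / 5))))) ->
  y + y ^+ 2 / (1 + y) + d ^+ 4 / (36 * 36 * (1 + 2 * y)) <=
    d ^+ 2 * (5 / 72 + d ^+ 2 / 192 + d ^+ 4 / 64 / 96 + d ^+ 6 / 64 / 64 / 60).
Proof.
move=> d0 d4 yl yu.
have y0 : 0 <= y.
  apply: le_trans yl; rewrite mulr_ge0 ?divr_ge0 ?exprn_ge0//.
  by rewrite addr_ge0// mulr_ge0 ?addr_ge0// ?divr_ge0.
(* Here [l] is the left end of a piece, where the lower bound on y justifies [c], and [s] is the
   value of (1 + a)^(-2), passed explicitly to keep the goals polynomial in d. *)
have H (l c k0 k1 a s : R) : s * (1 + a) ^+ 2 = 1 ->
    0 <= l -> l <= d -> 0 <= c -> 0 <= a ->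
    1 <= c * (1 + l ^+ 2 / 12 * (1 + l / 5 * (1 + l / 6))) ->
    24^-1 * (1 + d / 5 * (1 + d / 6 * (1 + d / 7 * (1 + d / 8 * (1 + d / 5)))))
      <= k0 + k1 * d ->
    (k0 + k1 * d) * (1 + a ^+ 2 * s)
    + d ^+ 2 * (k0 + k1 * d) ^+ 2 * s + c * d ^+ 2 / 36 / 36
    <= 5 / 72 + d ^+ 2 / 192 + d ^+ 4 / 64 / 96 + d ^+ 6 / 64 / 64 / 60 ->
  y + y ^+ 2 / (1 + y) + d ^+ 4 / (36 * 36 * (1 + 2 * y)) <=
    d ^+ 2 * (5 / 72 + d ^+ 2 / 192 + d ^+ 4 / 64 / 96 + d ^+ 6 / 64 / 64 / 60).
  move=> sE l0 ld c0 a0 cl kd.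
  have -> : s = ((1 + a) ^+ 2)^-1.
    apply: (mulIf (x := (1 + a) ^+ 2)); rewrite ?sE ?mulVf//;
      by rewrite expf_neq0// gt_eqF// ltr_pwDl.
  apply: growth_bound_of_chord => //.
    apply: le_trans cl _; rewrite ler_wpM2l// lerD2l.
    apply: le_trans (ler_wpM2l (ler0n _ 2) yl).
    have -> : 2 * (d ^+ 2 / 24 * (1 + d / 5 * (1 + d / 6))) =
        d ^+ 2 / 12 * (1 + d / 5 * (1 + d / 6)) by field.
    have l6 : 0 <= 1 + l / 6 by rewrite addr_ge0 ?divr_ge0.
    have l56 : 0 <= l / 5 * (1 + l / 6) by rewrite mulr_ge0 ?divr_ge0.
    rewrite ler_pM ?divr_ge0 ?addr_ge0 ?exprn_ge0// ?ler_wpM2r ?lerXn2r ?nnegrE//.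
    by rewrite lerD2l ler_pM ?divr_ge0 ?ler_wpM2r// lerD2l ler_wpM2r.
  by apply: le_trans yu _; rewrite -mulrA ler_wpM2l// sqr_ge0.
have chords (l h : R) : 0 <= l -> l <= d -> d <= h ->
    forall i, 0 <= d ^+ i * ((d - l) * (h - d)).
  by move=> l0 ld dh i; rewrite !mulr_ge0 ?exprn_ge0 ?subr_ge0.
have berns (l h : R) : l <= d -> d <= h ->
    forall i j, 0 <= (d - l) ^+ i * (h - d) ^+ j.
  by move=> ld dh i j; rewrite !mulr_ge0 ?exprn_ge0 ?subr_ge0.
have [d2|d2] := lerP d 2.
  have ch := chords 0 2 (lexx _) d0 d2.
  have bn := berns 0 2 d0 d2.
  apply: (H 0 1 (42 / 10 / 100) (13 / 10 / 100) 4^-1 (16 / 25)) => //;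
    [lra..| |].
    by chord_lra ch.
  by bernstein_lra bn.
have [d3|d3] := lerP d (5 / 2).
  have ch := chords 2 (5 / 2) (ler0n _ _) (ltW d2) d3.
  have bn := berns 2 (5 / 2) (ltW d2) d3.
  apply: (H 2 (67 / 100) (262 / 100 / 100) (2 / 100) 2^-1 (4 / 9)) => //;
    [lra..| |].
    by chord_lra ch.
  by bernstein_lra bn.
have [d5|d5] := lerP d 3.
  have ch := chords (5 / 2) 3 ltac:(lra) (ltW d3) d5.
  have bn := berns (5 / 2) 3 (ltW d3) d5.
  apply: (H (5 / 2) (54 / 100) (16 / 10 / 100) (24 / 10 / 100) (8 / 10) (100 / 324)) => //;
    [lra..| |].
    by chord_lra ch.
  by bernstein_lra bn.
have [d6|d6] := lerP d (7 / 2).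
  have ch := chords 3 (7 / 2) ltac:(lra) (ltW d5) d6.
  have bn := berns 3 (7 / 2) (ltW d5) d6.
  apply: (H 3 (42 / 100) (- (22 / 100 / 100)) (3 / 100) (11 / 10) (100 / 441)) => //;
    [lra..| |].
    by chord_lra ch.
  by bernstein_lra bn.
have ch := chords (7 / 2) 4 ltac:(lra) (ltW d6) d4.
have bn := berns (7 / 2) 4 (ltW d6) d4.
apply: (H (7 / 2) (33 / 100) (- (302 / 100 / 100)) (38 / 10 / 100) (3 / 2) (4 / 25)) => //;
    [lra..| |].
  by chord_lra ch.
by bernstein_lra bn.
Qed.

Definition exp_rem4 (R : realType) (x : R) : R :=
  expR x - (1 + x + x ^+ 2 / 2 + x ^+ 3 / 6).

Lemma quadratic_max (R : realType) (a b x : R) : 0 < a ->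
  b * x - a * x ^+ 2 <= b ^+ 2 / (4 * a).
Proof.
move=> a0; rewrite ler_pdivlMr ?mulr_gt0// -subr_ge0.
have -> : b ^+ 2 - (b * x - a * x ^+ 2) * (4 * a) = (b - 2 * a * x) ^+ 2 by ring.
exact: sqr_ge0.
Qed.

(* For d >= 4, [d ^+ 2 / 8] is replaced by its tangent d - 2 at d = 4. *)
Lemma growth_bound_large (R : realType) (d y : R) :
  4 <= d -> y = exp_rem4 d / d ^+ 2 ->
  d ^+ 2 / 16 * (2 + d ^+ 2 / 18 +
    (y + y ^+ 2 / (1 + y) + d ^+ 4 / (36 * 36 * (1 + 2 * y))))
    <= expR (d ^+ 2 / 8) - 1.
Proof.
move=> d4 dy.
have d0 : 0 < d by lra.
have d20 : 0 < d ^+ 2 by rewrite exprn_gt0.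
set A := exp_rem4 d in dy.
have yE : d ^+ 2 * y = A by rewrite dy mulrC divfK// gt_eqF.
(* Polynomial inequalities for d >= 4 follow by linear arithmetic from the nonnegative powers of d -
   4. *)
have t0 i : 0 <= (d - 4) ^+ i by rewrite exprn_ge0// subr_ge0.
have Al : d ^+ 4 / 24 * (1 + d / 5 * (1 + d / 6 * (1 + d / 7))) <= A.
  by have := expR_taylor7_le (ltW d0); rewrite /A /exp_rem4; lra.
have yl : d ^+ 2 / 24 * (1 + d / 5 * (1 + d / 6 * (1 + d / 7))) <= y.
  rewrite dy ler_pdivlMr//; apply: le_trans Al; apply: le_of_eq.
  by ring.
have y53 : 5 / 3 <= y.
  apply: le_trans yl; have := t0 1%N; have := t0 2%N; have := t0 3%N.
  by have := t0 4%N; have := t0 5%N; lra.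
(* The left side is y - 1 + 1 / (1 + y), and 1 / (1 + y) <= 3/8 because y >= 5/3. *)
have h1 : y ^+ 2 / (1 + y) <= y - 5 / 8.
  by rewrite ler_pdivrMr; nra.
have h2 : d ^+ 4 / (36 * 36 * (1 + 2 * y)) <= d ^+ 2 / 18 / 18.
  rewrite ler_pdivrMr; last by rewrite !mulr_gt0//; lra.
  have -> : d ^+ 2 / 18 / 18 * (36 * 36 * (1 + 2 * y)) =
    d ^+ 2 * (4 * (1 + 2 * y)) by field.
  rewrite (exprD _ 2 2) ler_wpM2l ?ltW//.
  have := t0 1%N; have := t0 2%N; have := t0 3%N.
  by have := t0 4%N; have := t0 5%N; lra.
(* The constant 0.1353 is slightly below e^(-2). *)
have e2 : expR 2 * (1353 / 100 / 100) <= 1 :> R.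
  have := @expR_le_taylor9 R 2 ltac:(lra) ltac:(lra); lra.
have h3 : 1353 / 100 / 100 * expR d <= expR (d ^+ 2 / 8).
  apply: (@le_trans _ _ (expR (d - 2))).
    have := ler_wpM2r (expR_ge0 (d - 2)) e2; have : expR d = expR (d - 2) * expR 2.
      by rewrite -expRD subrK.
    lra.
  by rewrite ler_expR -subr_ge0; have := t0 2%N; lra.
have dA : expR d = A + (1 + d + d ^+ 2 / 2 + d ^+ 3 / 6) by rewrite /A subrK.
apply: (@le_trans _ _ (d ^+ 2 / 16 * (2 + d ^+ 2 / 18 +
    (y + (y - 5 / 8) + d ^+ 2 / 18 / 18)))).
  apply: ler_wpM2l; first by rewrite divr_ge0// ltW.
  by rewrite lerD2l lerD// lerD2l.
have -> : d ^+ 2 / 16 * (2 + d ^+ 2 / 18 + (y + (y - 5 / 8) + d ^+ 2 / 18 / 18)) =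
  d ^+ 2 * y / 8 + 11 * d ^+ 2 / 128 + d ^+ 4 * 19 / 72 / 72 by field.
(* Now [A] has coefficient 1/8 on the left and 0.1353 on the right, so the lower bound [Al] leaves a
   polynomial inequality in d. *)
rewrite yE lerBrDr; apply: le_trans h3; rewrite dA.
have := t0 1%N; have := t0 2%N; have := t0 3%N; have := t0 4%N.
by have := t0 5%N; have := t0 6%N; have := t0 7%N; lra.
Qed.

(** Here m and t stand for |E W^2| and E |W|^2; the left side collects the bounds on the quadratic
    part, the cubic part with k = d^2 / 6, and the tail. In m / d^2 and t / d^2 it separates into
    two concave quadratics of one variable, each replaced by its maximum. *)
Lemma moment_function_max (R : realType) (d m t : R) : 0 < d ->
  m / 2 + d ^+ 2 * t / 72 + (t / 2 - t ^+ 2 / d ^+ 2 - m ^+ 2 / d ^+ 2)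
    + (d ^+ 2 * t - 2 * t ^+ 2 - m ^+ 2) * (exp_rem4 d / d ^+ 4)
  <= expR (d ^+ 2 / 8) - 1.
Proof.
move=> d0.
have d20 : 0 < d ^+ 2 by rewrite exprn_gt0.
have A0 : d ^+ 4 / 24 * (1 + d / 5 * (1 + d / 6)) <= exp_rem4 d.
  have := expR_taylor7_le (ltW d0); rewrite /exp_rem4.
  have : 0 <= d ^+ 7 by rewrite exprn_ge0// ltW.
  lra.
pose y := exp_rem4 d / d ^+ 2.
have yl : d ^+ 2 / 24 * (1 + d / 5 * (1 + d / 6)) <= y.
  rewrite /y ler_pdivlMr//; apply: le_trans A0; apply: le_of_eq.
  by ring.
have y0 : 0 <= y.
  apply: le_trans yl; rewrite mulr_ge0 ?divr_ge0 ?ltW//.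
  by rewrite addr_gt0// mulr_gt0 ?addr_gt0// ?divr_gt0.
have y1 : 0 < 1 + y by lra.
have y2 : 0 < 1 + 2 * y by lra.
pose u := m / d ^+ 2; pose s := t / d ^+ 2.
have hu := quadratic_max 2^-1 u y1.
have hs := quadratic_max (2^-1 + d ^+ 2 / 72 + y) s y2.
have [n0 [n1 n2]] : d != 0 /\ 1 + y != 0 /\ 1 + 2 * y != 0 by rewrite !gt_eqF.
have -> : m / 2 + d ^+ 2 * t / 72 + (t / 2 - t ^+ 2 / d ^+ 2 - m ^+ 2 / d ^+ 2)
    + (d ^+ 2 * t - 2 * t ^+ 2 - m ^+ 2) * (exp_rem4 d / d ^+ 4)
  = d ^+ 2 * ((2^-1 * u - (1 + y) * u ^+ 2)
    + ((2^-1 + d ^+ 2 / 72 + y) * s - (1 + 2 * y) * s ^+ 2)).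
  by rewrite /u /s /y; field.
apply: le_trans (ler_wpM2l (ltW d20) (lerD hu hs)) _.
have -> : d ^+ 2 * ((2^-1) ^+ 2 / (4 * (1 + y)) +
    (2^-1 + d ^+ 2 / 72 + y) ^+ 2 / (4 * (1 + 2 * y))) =
  d ^+ 2 / 16 * (2 + d ^+ 2 / 18 +
    (y + y ^+ 2 / (1 + y) + d ^+ 4 / (36 * 36 * (1 + 2 * y)))).
  by field; rewrite n1 n2.
have [d4|/ltW d4] := lerP d 4; last exact: growth_bound_large.
have yu : y <= d ^+ 2 / 24 * (1 + d / 5 * (1 + d / 6 * (1 + d / 7 *
    (1 + d / 8 * (1 + d / 5))))).
  rewrite /y ler_pdivrMr// /exp_rem4 lerBlDr.
  apply: le_trans (expR_le_taylor9 (ltW d0) d4) _.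
  by apply: le_of_eq; field.
have hG := growth_bound_small (ltW d0) d4 yl yu.
have v0 : 0 <= d ^+ 2 / 8 by rewrite divr_ge0// ltW.
have := expR_taylor5_le v0.
rewrite lerBrDl; apply: le_trans; rewrite lerD2l.
apply: (@le_trans _ _ (d ^+ 2 / 16 * (2 + d ^+ 2 / 18 +
   d ^+ 2 * (5 / 72 + d ^+ 2 / 192 + d ^+ 4 / 64 / 96 + d ^+ 6 / 64 / 64 / 60)))).
  apply: ler_wpM2l; first by rewrite divr_ge0// ltW.
  by rewrite lerD2l.
by apply: le_of_eq; field.
Qed.

(** * Taylor estimate for the complex exponential *)

(** Starting from f4 >= 0, each of f3, f2, f1, f0 in turn is bounded below by its Taylor polynomial
    at 0, by monotonicity of the difference. *)
Lemma taylor3_le (R : realType) (f0 f1 f2 f3 f4 : R -> R) :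
  (forall x : R, is_derive x (1 : R) f0 (f1 x)) ->
  (forall x : R, is_derive x (1 : R) f1 (f2 x)) ->
  (forall x : R, is_derive x (1 : R) f2 (f3 x)) ->
  (forall x : R, is_derive x (1 : R) f3 (f4 x)) ->
  (forall x, 0 <= x -> 0 <= f4 x) ->
  f0 0 + f1 0 + f2 0 / 2 + f3 0 / 6 <= f0 1.
Proof.
move=> d0 d1 d2 d3 f4_ge0.
have h3 x : 0 <= x -> f3 0 <= f3 x.
  by move=> x0; apply: (le_of_derive_ge0 x0 d3) => t t0 _; exact: f4_ge0.
have h2 x : 0 <= x -> f2 0 + f3 0 * x <= f2 x.
  move=> x0; have : f2 0 - f3 0 * 0 <= f2 x - f3 0 * x.
    apply: (@le_of_derive_ge0 _ (fun t => f2 t - f3 0 * t) (fun t => f3 t - f3 0) _ x0).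
      by move=> t; apply: is_derive_eq; rewrite /GRing.scale/=; ring.
    by move=> t t0 _; rewrite subr_ge0 h3.
  by lra.
have h1 x : 0 <= x -> f1 0 + f2 0 * x + f3 0 / 2 * x ^+ 2 <= f1 x.
  move=> x0; have : f1 0 - (f2 0 * 0 + f3 0 / 2 * 0 ^+ 2) <=
      f1 x - (f2 0 * x + f3 0 / 2 * x ^+ 2).
    apply: (@le_of_derive_ge0 _ (fun t => f1 t - (f2 0 * t + f3 0 / 2 * t ^+ 2))
      (fun t => f2 t - (f2 0 + f3 0 * t)) _ x0).
      by move=> t; apply: is_derive_eq; rewrite /GRing.scale/=; field.
    by move=> t t0 _; rewrite subr_ge0 h2.
  by lra.
have : f0 0 - (f1 0 * 0 + f2 0 / 2 * 0 ^+ 2 + f3 0 / 6 * 0 ^+ 3) <=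
    f0 1 - (f1 0 * 1 + f2 0 / 2 * 1 ^+ 2 + f3 0 / 6 * 1 ^+ 3).
  apply: (@le_of_derive_ge0 _
    (fun t => f0 t - (f1 0 * t + f2 0 / 2 * t ^+ 2 + f3 0 / 6 * t ^+ 3))
    (fun t => f1 t - (f1 0 + f2 0 * t + f3 0 / 2 * t ^+ 2)) _ ler01).
    by move=> t; apply: is_derive_eq; rewrite /GRing.scale/=; field.
  by move=> t t0 _; rewrite subr_ge0 h1.
by lra.
Qed.

(** Cauchy-Schwarz against the unit vector (cos x, sin x), with defect (a sin x - b cos x)^2. *)
Lemma cos_sin_comb_le (R : realType) (a b c x : R) : 0 <= c ->
  a ^+ 2 + b ^+ 2 <= c ^+ 2 -> a * cos x + b * sin x <= c.
Proof.
move=> c0 abc; apply: le_trans (ler_norm _) _.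
rewrite -(ler_pXn2r (n := 2))// ?nnegrE// real_normK ?num_real//.
apply: le_trans abc; rewrite -subr_ge0.
have cs := cos2Dsin2 x.
have -> : a ^+ 2 + b ^+ 2 - (a * cos x + b * sin x) ^+ 2 =
  (a ^+ 2 + b ^+ 2) * (1 - (cos x ^+ 2 + sin x ^+ 2)) + (a * sin x - b * cos x) ^+ 2.
  by ring.
by rewrite cs subrr mulr0 add0r sqr_ge0.
Qed.

(** The function is the real part of (a - ib) e^(t(u + iv)); differentiating multiplies a - ib by u
    + iv and keeps the form, so the rule can be iterated. *)
Lemma is_derive_expR_cos_sin (R : realType) (u v a b x : R) :
  is_derive x (1 : R) (fun t => expR (t * u) * (a * cos (t * v) + b * sin (t * v)))
    (expR (x * u) * ((u * a + v * b) * cos (x * v) + (u * b - v * a) * sin (x * v))).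
Proof. by apply: is_derive_eq; rewrite /GRing.scale/=; ring. Qed.

(* For a unit vector (a, b) this is the cubic Taylor estimate of the real part of
   (a - ib) e^(u + iv). *)
Lemma expR_cos_sin_taylor (R : realType) (a b u v d : R) : 0 < d ->
  a ^+ 2 + b ^+ 2 = 1 -> u ^+ 2 + v ^+ 2 <= d ^+ 2 ->
  a * (expR u * cos v) + b * (expR u * sin v) <=
    a * (1 + u + (u ^+ 2 - v ^+ 2) / 2 + (u ^+ 3 - 3 * u * v ^+ 2) / 6)
    + b * (v + u * v + (3 * u ^+ 2 * v - v ^+ 3) / 6)
    + (u ^+ 2 + v ^+ 2) ^+ 2 * (exp_rem4 d / d ^+ 4).
Proof.
move=> d0 ab1 uvd; have dn0 : d != 0 by rewrite gt_eqF.
set r := u ^+ 2 + v ^+ 2 in uvd *.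
have r0 : 0 <= r by rewrite addr_ge0// sqr_ge0.
have ud : u <= d.
  apply: le_trans (ler_norm _) _; rewrite -(ler_pXn2r (n := 2))// ?nnegrE ?(ltW d0)//.
  by rewrite real_normK ?num_real//; apply: le_trans uvd; rewrite lerDl sqr_ge0.
pose a1 := u * a + v * b; pose b1 := u * b - v * a.
pose a2 := u * a1 + v * b1; pose b2 := u * b1 - v * a1.
pose a3 := u * a2 + v * b2; pose b3 := u * b2 - v * a2.
pose a4 := u * a3 + v * b3; pose b4 := u * b3 - v * a3.
(* Starting with c = r^2 / d^4, the fourth derivative has leading term r^2 e^(td). It dominates the
   rest because |a4 - i b4| = |u + iv|^4 = r^2 and u <= d. *)
pose f c a b t := c * expR (t * d) - expR (t * u) * (a * cos (t * v) + b * sin (t * v)).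
have df c a' b' x : is_derive x (1 : R) (f c a' b')
    (f (c * d) (u * a' + v * b') (u * b' - v * a') x).
  have dg := is_derive_expR_cos_sin u v a' b' x.
  by apply: is_derive_eq; rewrite /GRing.scale/= /f; ring.
have f40 x : 0 <= x -> 0 <= f (r ^+ 2 / d ^+ 4 * d * d * d * d) a4 b4 x.
  move=> x0; rewrite /f subr_ge0.
  have -> : r ^+ 2 / d ^+ 4 * d * d * d * d = r ^+ 2 by field.
  apply: (@le_trans _ _ (expR (x * u) * r ^+ 2)).
    rewrite ler_wpM2l ?expR_ge0//; apply: cos_sin_comb_le; first exact: sqr_ge0.
    have -> : a4 ^+ 2 + b4 ^+ 2 = r ^+ 4 * (a ^+ 2 + b ^+ 2).
      by rewrite /a4 /b4 /a3 /b3 /a2 /b2 /a1 /b1 /r; ring.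
    by rewrite ab1 mulr1 -exprM.
  by rewrite mulrC ler_wpM2l ?sqr_ge0// ler_expR ler_wpM2l.
have := taylor3_le (df _ _ _) (df _ _ _) (df _ _ _) (df _ _ _) f40.
rewrite /f !mul0r !mul1r expR0 cos0 sin0 !mulr0 !mulr1 !addr0 !mul1r /exp_rem4.
set e := expR d; set cu := expR u * cos v; set su := expR u * sin v.
have -> : expR u * (a * cos v + b * sin v) = a * cu + b * su by rewrite /cu /su; ring.
rewrite -subr_ge0 => h; rewrite -subr_ge0.
apply: le_trans h _; apply: le_of_eq.
by rewrite /a3 /b3 /a2 /b2 /a1 /b1; field.
Qed.

(** * Means of bounded functions *)

Section mean.
Context (disp : measure_display) (T : measurableType disp) (R : realType)
  (P : probability T R).

(** The bound holds everywhere, not just almost everywhere, so that the class is closed under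
    products and every mean below is finite. *)
Definition bounded_mfun (f : T -> R) :=
  measurable_fun [set: T] f /\ exists M, forall x, `|f x| <= M.

Definition mean (f : T -> R) : R := fine (\int[P]_x (f x)%:E)%E.

Lemma bounded_mfun_cst c : bounded_mfun (fun=> c).
Proof. by split; [exact: measurable_cst | exists `|c|]. Qed.

Lemma bounded_mfunD f g : bounded_mfun f -> bounded_mfun g ->
  bounded_mfun (fun x => f x + g x).
Proof.
move=> [mf [M fM]] [mg [N gN]]; split; first exact: measurable_funD.
by exists (M + N) => x; apply: le_trans (ler_normD _ _) (lerD (fM x) (gN x)).
Qed.

Lemma bounded_mfunM f g : bounded_mfun f -> bounded_mfun g ->
  bounded_mfun (fun x => f x * g x).
Proof.
move=> [mf [M fM]] [mg [N gN]]; split; first exact: measurable_funM.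
by exists (M * N) => x; rewrite normrM ler_pM.
Qed.

Lemma bounded_mfunN f : bounded_mfun f -> bounded_mfun (fun x => - f x).
Proof.
move=> [mf [M fM]]; split; last by exists M => x; rewrite normrN.
exact: measurableT_comp.
Qed.

Lemma bounded_mfunX f n : bounded_mfun f -> bounded_mfun (fun x => f x ^+ n).
Proof.
move=> [mf [M fM]]; split; first exact: measurable_funX.
by exists (M ^+ n) => x; rewrite normrX lerXn2r ?nnegrE// (le_trans _ (fM x)).
Qed.

Lemma bounded_mfun_integrable f : bounded_mfun f ->
  P.-integrable [set: T] (EFin \o f).
Proof.
move=> [mf [M fM]]; apply: measurable_bounded_integrable => //.
  by rewrite (le_lt_trans (probability_le1 P measurableT))// ltry.
exists M; split; first exact: num_real.
by move=> N MN x _ /=; exact: le_trans (fM x) (ltW MN).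
Qed.

Lemma mean_cst c : mean (fun=> c) = c.
Proof. by rewrite /mean integral_cst// [X in (_ * X)%E](probability_setT P) mule1. Qed.

Lemma meanD f g : bounded_mfun f -> bounded_mfun g ->
  mean (fun x => f x + g x) = mean f + mean g.
Proof.
by move=> /bounded_mfun_integrable fi /bounded_mfun_integrable; exact: RintegralD.
Qed.

Lemma meanZ c f : bounded_mfun f -> mean (fun x => c * f x) = c * mean f.
Proof. by move=> /bounded_mfun_integrable fi; exact: RintegralZl. Qed.

Lemma mean_ae_eq f g : measurable_fun [set: T] f -> measurable_fun [set: T] g ->
  {ae P, forall x, f x = g x} -> mean f = mean g.
Proof.
move=> mf mg fg; rewrite /mean; congr fine.
apply: ae_eq_integral => //; [exact/measurable_EFinP|exact/measurable_EFinP|].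
by apply: filterS fg => x fgx _ /=; rewrite fgx.
Qed.

Lemma mean_ae_ge0 f : bounded_mfun f -> {ae P, forall x, 0 <= f x} -> 0 <= mean f.
Proof.
move=> [mf fM] f0; rewrite (@mean_ae_eq _ (fun x => Num.max (f x) 0))//.
- by apply: fine_ge0; apply: integral_ge0 => x _; rewrite lee_fin le_max lexx orbT.
- exact: measurable_maxr.
- by apply: filterS f0 => x /max_idPl ->.
Qed.

Lemma mean_ae_le f g : bounded_mfun f -> bounded_mfun g ->
  {ae P, forall x, f x <= g x} -> mean f <= mean g.
Proof.
move=> bf bg fg; have bNf : bounded_mfun (fun x => -1 * f x).
  by apply: bounded_mfunM => //; exact: bounded_mfun_cst.
have : 0 <= mean (fun x => g x + -1 * f x).
  apply: mean_ae_ge0; first exact: bounded_mfunD.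
  by apply: filterS fg => x; rewrite mulN1r subr_ge0.
by rewrite meanD// meanZ// mulN1r subr_ge0.
Qed.

Fixpoint all_bounded (s : seq (R * (T -> R))) : Prop :=
  if s is p :: s' then bounded_mfun p.2 /\ all_bounded s' else True.

Lemma mean_lin s : all_bounded s ->
  bounded_mfun (fun x => \sum_(p <- s) p.1 * p.2 x) /\
  mean (fun x => \sum_(p <- s) p.1 * p.2 x) = \sum_(p <- s) p.1 * mean p.2.
Proof.
elim: s => [_|[c f] s IHs [/= bf /IHs[bs ms]]].
  under eq_fun do rewrite big_nil.
  by rewrite big_nil mean_cst; split=> //; exact: bounded_mfun_cst.
have bcf : bounded_mfun (fun x => c * f x).
  by apply: bounded_mfunM => //; exact: bounded_mfun_cst.
under eq_fun do rewrite big_cons.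
rewrite big_cons; split; first exact: bounded_mfunD.
by rewrite meanD// meanZ// ms.
Qed.

(** Expands the mean of a long expression in one step: the list gives coefficients and functions,
    and the pointwise identity is left to [ring] or [field]. *)
Lemma mean_lin_eq f s : all_bounded s ->
  (forall x, f x = \sum_(p <- s) p.1 * p.2 x) ->
  bounded_mfun f /\ mean f = \sum_(p <- s) p.1 * mean p.2.
Proof. by move=> bs /funext ->; exact: mean_lin. Qed.

End mean.

(** * Moments of a bounded centred complex variable *)

Ltac bounded := repeat (assumption || apply: bounded_mfun_cst ||
  apply: bounded_mfunD || apply: bounded_mfunM || apply: bounded_mfunN ||
  apply: bounded_mfunX).

Ltac all_bounded := rewrite /=;
  repeat match goal with |- _ /\ _ => split end; first [exact: I | bounded].

Section centred_pair.
Context (disp : measure_display) (T : measurableType disp) (R : realType)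
  (P : probability T R).
Variables (u v : T -> R) (d : R).
Hypotheses (d0 : 0 < d) (bu : bounded_mfun u) (bv : bounded_mfun v).
Hypotheses (u0 : mean P u = 0) (v0 : mean P v = 0).
Hypothesis uvd : {ae P, forall x, {ae P, forall y,
  (u x - u y) ^+ 2 + (v x - v y) ^+ 2 <= d ^+ 2}}.

(** With W = u + iv, [n2] is |W|^2, while [M2], [M4] and [S] are the quantities T, M and m^2 of the
    overview. *)
Let n2 x := u x ^+ 2 + v x ^+ 2.
Let bn2 : bounded_mfun n2. Proof. by bounded. Qed.
Let Euu := mean P (fun x => u x ^+ 2).
Let Evv := mean P (fun x => v x ^+ 2).
Let Euv := mean P (fun x => u x * v x).
Let M2 := Euu + Evv.
Let M4 := mean P (fun x => n2 x ^+ 2).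
(* S = |E (u + iv)^2|^2 *)
Let S := (Euu - Evv) ^+ 2 + (2 * Euv) ^+ 2.

Let mean_n2 : mean P n2 = M2.
Proof. by rewrite meanD//; bounded. Qed.

(** For fixed x the cross terms average to zero, which leaves |W(x)|^2 + E |W|^2 <= d^2. *)
Lemma sqr_norm_ae_le : {ae P, forall x, n2 x <= d ^+ 2}.
Proof.
apply: filterS uvd => x xd.
have [bl lE] := @mean_lin_eq _ _ _ P (fun y => (u x - u y) ^+ 2 + (v x - v y) ^+ 2)
  [:: (n2 x, fun=> 1); (- 2 * u x, u); (- 2 * v x, v); (1, n2)]
  ltac:(all_bounded) ltac:(by move=> y; rewrite !big_cons big_nil /n2 /=; ring).
have := mean_ae_le bl (bounded_mfun_cst T (d ^+ 2)) xd.
rewrite lE !big_cons big_nil /= !mean_cst u0 v0 mean_n2 !mulr0 !add0r mulr1 mul1r addr0.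
apply: le_trans; rewrite lerDl addr_ge0//; apply: mean_ae_ge0 => //; bounded.
all: by apply: aeW => y; rewrite sqr_ge0.
Qed.

(** With l = |W(x) - W(y)|^2, the nonnegative quantity l (d^2 - l) is averaged first over y, which
    gives [h], and then over x, where the terms in [a] and [b] vanish. *)
Lemma moment4_le : M4 <= d ^+ 2 * M2 - 2 * M2 ^+ 2 - S.
Proof.
pose a := mean P (fun x => n2 x * u x); pose b := mean P (fun x => n2 x * v x).
have h : {ae P, forall x, 0 <= d ^+ 2 * (n2 x + M2) - (n2 x ^+ 2 + M4
   + 4 * (Euu * u x ^+ 2 + Evv * v x ^+ 2 + 2 * Euv * (u x * v x))
   + 2 * n2 x * M2 - 4 * (u x * a + v x * b))}.
  apply: filterS uvd => x xd.
  have [bl lE] := @mean_lin_eq _ _ _ P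
    (fun y => let l := (u x - u y) ^+ 2 + (v x - v y) ^+ 2 in l * (d ^+ 2 - l))
    [:: (d ^+ 2 * n2 x - n2 x ^+ 2, fun=> 1);
        (- 2 * (d ^+ 2 - 2 * n2 x) * u x, u); (- 2 * (d ^+ 2 - 2 * n2 x) * v x, v);
        (d ^+ 2 - 2 * n2 x, n2); (-1, fun y => n2 y ^+ 2);
        (- 4 * u x ^+ 2, fun y => u y ^+ 2); (- 4 * v x ^+ 2, fun y => v y ^+ 2);
        (- 8 * (u x * v x), fun y => u y * v y);
        (4 * u x, fun y => n2 y * u y); (4 * v x, fun y => n2 y * v y)]
    ltac:(all_bounded) ltac:(by move=> y; rewrite !big_cons big_nil /n2 /=; ring).
  have : {ae P, forall y, 0 <= (let l := (u x - u y) ^+ 2 + (v x - v y) ^+ 2 in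
     l * (d ^+ 2 - l))}.
    apply: filterS xd => y yd /=; rewrite mulr_ge0 ?subr_ge0//.
    by rewrite addr_ge0 ?sqr_ge0.
  move=> /(mean_ae_ge0 bl); rewrite lE !big_cons big_nil /= mean_cst u0 v0 mean_n2.
  rewrite -/M4 -/Euu -/Evv -/Euv -/a -/b => {}lE; apply: le_trans lE _.
  by apply: le_of_eq; ring.
have [bl lE] := @mean_lin_eq _ _ _ P (fun x => d ^+ 2 * (n2 x + M2) - (n2 x ^+ 2 + M4
   + 4 * (Euu * u x ^+ 2 + Evv * v x ^+ 2 + 2 * Euv * (u x * v x))
   + 2 * n2 x * M2 - 4 * (u x * a + v x * b)))
   [:: (d ^+ 2 * M2 - M4, fun=> 1); (d ^+ 2 - 2 * M2, n2); (-1, fun x => n2 x ^+ 2);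
       (- 4 * Euu, fun y => u y ^+ 2); (- 4 * Evv, fun y => v y ^+ 2);
       (- 8 * Euv, fun y => u y * v y); (4 * a, u); (4 * b, v)]
    ltac:(all_bounded) ltac:(by move=> y; rewrite !big_cons big_nil /n2 /=; ring).
have := mean_ae_ge0 bl h; rewrite lE !big_cons big_nil /= mean_cst u0 v0 mean_n2.
(* The quadratic terms combine through 2 (Euu^2 + Evv^2 + 2 Euv^2) = M2^2 + S. *)
rewrite -/M4 -/Euu -/Evv -/Euv /S /M2; lra.
Qed.

(* With W = u + iv, AM-GM for the product of W and W^2 - E W^2, whose mean is
   E W^3. *)
Lemma moment3_le (a b k : R) : 0 < k -> a ^+ 2 + b ^+ 2 = 1 ->
  mean P (fun x => a * (u x ^+ 3 - 3 * u x * v x ^+ 2)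
                   + b * (3 * u x ^+ 2 * v x - v x ^+ 3))
    <= (k * M2 + (M4 - S) / k) / 2.
Proof.
move=> k0 ab1; set C := (X in mean _ X).
have bC : bounded_mfun C by rewrite /C; bounded.
pose p := Euu - Evv; pose q := 2 * Euv.
have [bl lE] := @mean_lin_eq _ _ _ P
  (fun x => (k * n2 x + (n2 x ^+ 2 -
     2 * (p * (u x ^+ 2 - v x ^+ 2) + q * (2 * (u x * v x)))
     + (p ^+ 2 + q ^+ 2)) / k) / 2
     - (C x - (a * (p * u x - q * v x) + b * (p * v x + q * u x))))
  [:: ((p ^+ 2 + q ^+ 2) / k / 2, fun=> 1); (k / 2, n2);
      (k^-1 / 2, fun x => n2 x ^+ 2); (- p / k, fun x => u x ^+ 2);
      (p / k, fun x => v x ^+ 2); (- 2 * q / k, fun x => u x * v x);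
      (-1, C); (a * p + b * q, u); (b * p - a * q, v)]
  ltac:(all_bounded)
  ltac:(by move=> y; rewrite !big_cons big_nil /=; field; rewrite gt_eqF).
have : {ae P, forall x, 0 <= (k * n2 x + (n2 x ^+ 2 -
     2 * (p * (u x ^+ 2 - v x ^+ 2) + q * (2 * (u x * v x)))
     + (p ^+ 2 + q ^+ 2)) / k) / 2
     - (C x - (a * (p * u x - q * v x) + b * (p * v x + q * u x)))}.
  apply: aeW => x.
  (* Here y1 + i y2 = W^2 - E W^2, and the integrand is |y1 + i y2 - k (a + ib) conj(W)|^2 / (2k)
     since |a + ib| = 1. *)
  pose y1 := u x ^+ 2 - v x ^+ 2 - p; pose y2 := 2 * (u x * v x) - q.
  rewrite [leRHS](_ : _ = ((y1 - k * (a * u x + b * v x)) ^+ 2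
    + (y2 - k * (b * u x - a * v x)) ^+ 2
    + (1 - (a ^+ 2 + b ^+ 2)) * k ^+ 2 * n2 x) / k / 2).
    by rewrite ab1 subrr !mul0r addr0 !divr_ge0 ?addr_ge0 ?sqr_ge0 ?ltW.
  by rewrite /y1 /y2 /C /n2; field; rewrite gt_eqF.
move=> /(mean_ae_ge0 bl); rewrite lE !big_cons big_nil /= mean_cst u0 v0 mean_n2.
rewrite -/M4 -/Euu -/Evv -/Euv => h; rewrite -subr_ge0; apply: le_trans h _.
apply: le_of_eq.
by rewrite /S /p /q; field; rewrite gt_eqF.
Qed.

(** The left side is the real part of (a - ib) (E e^W - 1); a suitable unit vector (a, b) turns it
    into the modulus. *)
Lemma mean_exp_centred_le (a b : R) : a ^+ 2 + b ^+ 2 = 1 ->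
  a * (mean P (fun x => expR (u x) * cos (v x)) - 1)
    + b * mean P (fun x => expR (u x) * sin (v x)) <= expR (d ^+ 2 / 8) - 1.
Proof.
move=> ab1.
pose K := exp_rem4 d / d ^+ 4.
have K0 : 0 <= K.
  rewrite divr_ge0 ?exprn_ge0// ?(ltW d0)// /exp_rem4 subr_ge0.
  have := expR_taylor5_le (ltW d0); apply: le_trans.
  have : 0 <= d ^+ 4 by rewrite exprn_ge0// ltW.
  have : 0 <= d ^+ 5 by rewrite exprn_ge0// ltW.
  by lra.
have [mu [Mu uM]] := bu; have [mv [Mv vM]] := bv.
have bexp : bounded_mfun (fun x => expR (u x)).
  split; first exact: measurableT_comp (@measurable_expR R) mu.
  exists (expR Mu) => x.
  by rewrite ger0_norm ?expR_ge0// ler_expR (le_trans (ler_norm _)).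
have bcos : bounded_mfun (fun x => cos (v x)).
  split.
    exact: measurableT_comp (continuous_measurable_fun (@continuous_cos R)) mv.
  by exists 1 => x; rewrite ler_norml cos_geN1 cos_le1.
have bsin : bounded_mfun (fun x => sin (v x)).
  split.
    exact: measurableT_comp (continuous_measurable_fun (@continuous_sin R)) mv.
  by exists 1 => x; rewrite ler_norml sin_geN1 sin_le1.
pose C x := a * (u x ^+ 3 - 3 * u x * v x ^+ 2) + b * (3 * u x ^+ 2 * v x - v x ^+ 3).
have bC : bounded_mfun C by rewrite /C; bounded.
have [bl lE] := @mean_lin_eq _ _ _ P
  (fun x => a * (expR (u x) * cos (v x)) + b * (expR (u x) * sin (v x)))
  [:: (a, fun x => expR (u x) * cos (v x)); (b, fun x => expR (u x) * sin (v x))]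
  ltac:(all_bounded) ltac:(by move=> y; rewrite !big_cons big_nil /=; ring).
have [br rE] := @mean_lin_eq _ _ _ P
  (fun x => a * (1 + u x + (u x ^+ 2 - v x ^+ 2) / 2) + b * (v x + u x * v x)
     + C x / 6 + n2 x ^+ 2 * K)
  [:: (a, fun=> 1); (a, u); (a / 2, fun x => u x ^+ 2); (- a / 2, fun x => v x ^+ 2);
      (b, v); (b, fun x => u x * v x); (6^-1, C); (K, fun x => n2 x ^+ 2)]
  ltac:(all_bounded) ltac:(by move=> y; rewrite !big_cons big_nil /=; field).
have : {ae P, forall x, a * (expR (u x) * cos (v x)) + b * (expR (u x) * sin (v x)) <=
    a * (1 + u x + (u x ^+ 2 - v x ^+ 2) / 2) + b * (v x + u x * v x)
     + C x / 6 + n2 x ^+ 2 * K}.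
  apply: filterS sqr_norm_ae_le => x /(expR_cos_sin_taylor d0 ab1)/le_trans; apply.
  by apply: le_of_eq; rewrite /C /n2 /K; field; rewrite gt_eqF.
move=> /(mean_ae_le bl br); rewrite lE rE !big_cons !big_nil /= mean_cst u0 v0.
rewrite -/M4 -/Euu -/Evv -/Euv => h.
(* With k = d^2 / 6 the cubic term is at most d^2 M2 / 72 + (M4 - S) / (2 d^2), as
   [moment_function_max] expects. *)
have k0 : 0 < d ^+ 2 / 6 by rewrite divr_gt0// exprn_gt0.
have h3 := moment3_le k0 ab1; rewrite -/C in h3.
have h4 := moment4_le.
pose m := Num.sqrt S.
have S0 : 0 <= S by rewrite addr_ge0// sqr_ge0.
have mS : m ^+ 2 = S by rewrite sqr_sqrtr.
(* Cauchy-Schwarz: the real part of (a - ib) E W^2 is at most |E W^2|. *)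
have hm : a * (Euu - Evv) + b * (2 * Euv) <= m.
  apply: le_trans (ler_norm _) _; rewrite -(ler_pXn2r (n := 2))// ?nnegrE ?sqrtr_ge0//.
  rewrite real_normK ?num_real// mS -subr_ge0.
  rewrite [leRHS](_ : _ = (a * (2 * Euv) - b * (Euu - Evv)) ^+ 2
    + (1 - (a ^+ 2 + b ^+ 2)) * S); last by rewrite /S; ring.
  by rewrite ab1 subrr mul0r addr0 sqr_ge0.
have h5 : (M4 - S) / (d ^+ 2 / 6) <= (d ^+ 2 * M2 - 2 * M2 ^+ 2 - S - S) / (d ^+ 2 / 6).
  by rewrite ler_wpM2r ?invr_ge0 ?(ltW k0)// lerD2r.
have h6 := ler_wpM2r K0 h4.
have := moment_function_max m M2 d0; rewrite mS -/K => h7.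
have e5 : (d ^+ 2 * M2 - 2 * M2 ^+ 2 - S - S) / (d ^+ 2 / 6) / 12 =
  M2 / 2 - M2 ^+ 2 / d ^+ 2 - S / d ^+ 2 by field; rewrite gt_eqF.
lra.
Qed.

End centred_pair.

(** * The bound for complex random variables *)

(** The product measure integrates the measures of the sections, so almost every section of a null
    set is null. *)
Lemma product_null_ae (disp : measure_display) (T : measurableType disp)
    (R : realType) (P : probability T R) (A : set (T * T)) :
  measurable A -> (P \x P)%E A = 0%E ->
  {ae P, forall x, {ae P, forall y, ~ A (x, y)}}.
Proof.
move=> mA PA.
have : (\int[P]_x `|(P \o xsection A) x| = 0)%E.
  by rewrite -[RHS]PA; apply: eq_integral => x _; rewrite gee0_abs.
move=> /(ae_eq_integral_abs P measurableT (measurable_fun_xsection P mA)).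
apply: filterS => x /(_ I) /= Px.
exists (xsection A x); split => //; first exact: measurable_xsection.
by move=> y /= /contrapT Axy; rewrite /xsection/= inE.
Qed.

(** Strictness yields an admissible c < d in the set whose infimum is the diameter, whether or not
    that infimum is attained. *)
Lemma diam_lt_ae (disp : measure_display) (T : measurableType disp)
    (R : realType) (P : probability T R) (d : R) (Z : T -> R[i]) :
  complex_random_variable Z -> (diam P Z < d%:E)%E ->
  0 < d /\ {ae P, forall x, {ae P, forall y,
    (complex.Re (Z x) - complex.Re (Z y)) ^+ 2
    + (complex.Im (Z x) - complex.Im (Z y)) ^+ 2 <= d ^+ 2}}.
Proof.
move=> [mX mY] /ereal_inf_lt[_ [c /= Pc <-]]; rewrite lte_fin => cd.
pose q (w : T * T) := (complex.Re (Z w.1) - complex.Re (Z w.2)) ^+ 2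
    + (complex.Im (Z w.1) - complex.Im (Z w.2)) ^+ 2.
have q0 w : 0 <= q w by rewrite addr_ge0// sqr_ge0.
have normE w : `|Z w.1 - Z w.2| = (Num.sqrt (q w))%:C.
  by rewrite normc_def /q; case: (Z w.1) => ? ?; case: (Z w.2).
(* For c < 0 the event would be the whole product space, of measure 1. *)
have c0 : 0 <= c.
  rewrite leNgt; apply/negP => c0; move: Pc.
  rewrite (_ : [set _ | _] = setT); last first.
    apply/seteqP; split=> // w _ /=.
    by rewrite normE ltcR (lt_le_trans c0)// sqrtr_ge0.
  rewrite -setXTT product_measure1E// [X in (X * _)%E](probability_setT P).
  by rewrite [X in (_ * X)%E](probability_setT P) mule1 => /eqP; rewrite onee_eq0.
have d0 : 0 < d by exact: le_lt_trans cd.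
split=> //.
have AE : [set w : T * T | c%:C < `|Z w.1 - Z w.2|] = [set w | c ^+ 2 < q w].
  apply/funext => w; apply/propext; rewrite /= normE ltcR.
  by rewrite -[in c ^+ 2 < _](sqr_sqrtr (q0 w)) ltr_pXn2r ?nnegrE ?sqrtr_ge0.
have mq : measurable_fun [set: T * T] q.
  have m1 (f : T -> R) : measurable_fun setT f ->
      measurable_fun setT (fun w : T * T => f w.1).
    by move=> mf; exact: measurableT_comp mf measurable_fst.
  have m2 (f : T -> R) : measurable_fun setT f ->
      measurable_fun setT (fun w : T * T => f w.2).
    by move=> mf; exact: measurableT_comp mf measurable_snd.
  apply: measurable_funD; apply: measurable_funX; apply: measurable_funB;
    by [exact: (m1 _ mX) | exact: (m2 _ mX) | exact: (m1 _ mY) | exact: (m2 _ mY)].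
have mA : measurable [set w | c ^+ 2 < q w].
  have := @measurable_fun_ltr _ _ _ _ (fun=> c ^+ 2) q (measurable_cst _) mq
    measurableT [set true] ltac:(done).
  by rewrite setTI; congr measurable; apply/seteqP; split => w.
rewrite AE in Pc.
apply: filterS (product_null_ae mA Pc) => x; apply: filterS => y /= /negP.
rewrite -leNgt => /le_trans; apply.
by rewrite lerXn2r ?nnegrE ?(ltW cd)// ltW.
Qed.

(** Truncating X to [a - d, a + d] changes it only on a null set and makes it bounded everywhere. *)
Lemma clamp_bounded (disp : measure_display) (T : measurableType disp)
    (R : realType) (P : probability T R) (d a : R) (X : T -> R) :
  0 <= d -> measurable_fun [set: T] X ->
  {ae P, forall y, (a - X y) ^+ 2 <= d ^+ 2} ->
  exists2 X' : T -> R, bounded_mfun X' & {ae P, forall y, X' y = X y}.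
Proof.
move=> d0 mX aX; exists (fun y => Num.max (a - d) (Num.min (X y) (a + d))).
  split; first by apply: measurable_maxr => //; exact: measurable_minr.
  exists (`|a| + d) => y; rewrite ler_norml; apply/andP; split.
    rewrite le_max; apply/orP; left.
    by rewrite opprD lerD2r lerNnormlW.
  rewrite ge_max ge_min; apply/andP; split.
    by rewrite lerD ?ler_norm// (le_trans _ d0)// oppr_le0.
  by rewrite lerD2r ler_norm orbT.
apply: filterS aX => y; rewrite -[in _ <= _]real_normK ?num_real//.
rewrite ler_pXn2r ?nnegrE// ler_distl => /andP[yd dy].
by rewrite min_l -?lerBlDr// max_r// lerBlDr.
Qed.

Lemma cexpectation_exp_le_of_diam_lt (disp : measure_display)
    (T : measurableType disp) (R : realType) (P : probability T R) (d : R)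
    (Z : T -> R[i]) : complex_random_variable Z -> (diam P Z < d%:E)%E ->
  `|cexpectation P (fun w => cexp (Z w - cexpectation P Z)) - 1|
    <= (expR (d ^+ 2 / 8) - 1)%:C.
Proof.
move=> hZ hd; have [d0 zd] := diam_lt_ae hZ hd; have [mX mY] := hZ.
pose X w := complex.Re (Z w); pose Y w := complex.Im (Z w).
have PT0 : (0 < P [set: T])%E by rewrite [ltRHS](probability_setT P) lte01.
have FP := ae_properfilter_algebraOfSetsType PT0.
(* Since P has mass 1, an almost sure property holds at some point; both parts of Z are almost
   surely within d of their values at [x0]. *)
have [x0 zx0] := filter_ex zd.
have [X' bX eqX] : exists2 X' : T -> R, bounded_mfun X' & {ae P, forall y, X' y = X y}.
  apply: (@clamp_bounded _ _ _ _ d (X x0)) => //; first exact: ltW.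
  by apply: filterS zx0 => y; apply: le_trans; rewrite lerDl sqr_ge0.
have [Y' bY eqY] : exists2 Y' : T -> R, bounded_mfun Y' & {ae P, forall y, Y' y = Y y}.
  apply: (@clamp_bounded _ _ _ _ d (Y x0)) => //; first exact: ltW.
  by apply: filterS zx0 => y; apply: le_trans; rewrite lerDr sqr_ge0.
pose cx := mean P X'; pose cy := mean P Y'.
have EZ : cexpectation P Z = cx +i* cy.
  rewrite /cexpectation !expectation.unlock; congr (_ +i* _).
    by apply: mean_ae_eq => //; [case: bX | apply: filterS eqX => y ->].
  by apply: mean_ae_eq => //; [case: bY | apply: filterS eqY => y ->].
pose u w := X' w - cx; pose v w := Y' w - cy.
have bu : bounded_mfun u by rewrite /u; bounded.
have bv : bounded_mfun v by rewrite /v; bounded.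
have u0 : mean P u = 0 by rewrite /u meanD ?mean_cst ?subrr//; bounded.
have v0 : mean P v = 0 by rewrite /v meanD ?mean_cst ?subrr//; bounded.
have uvd : {ae P, forall x, {ae P, forall y,
    (u x - u y) ^+ 2 + (v x - v y) ^+ 2 <= d ^+ 2}}.
  move: (eqX) (eqY) (zd); apply: filterS3 => x xE yE.
  move: (eqX) (eqY); apply: filterS3 => y xE' dy.
  by rewrite /u /v xE xE' yE dy !opprB !addrA !subrK.
set c := mean P (fun x => expR (u x) * cos (v x)).
set s := mean P (fun x => expR (u x) * sin (v x)).
have EE : cexpectation P (fun w => cexp (Z w - cexpectation P Z)) = c +i* s.
  have cexpE w : cexp (Z w - (cx +i* cy)) =
      (expR (X w - cx) * cos (Y w - cy)) +i* (expR (X w - cx) * sin (Y w - cy)).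
    rewrite /cexp /X /Y; case: (Z w) => x y; apply/eqP.
    by rewrite eq_complex /= !mul0r subr0 addr0 !eqxx.
  have mXc : measurable_fun [set: T] (fun w => expR (X w - cx)).
    by apply: measurableT_comp (@measurable_expR R) _; exact: measurable_funB.
  have mtrig (f : R -> R) : continuous f ->
      measurable_fun [set: T] (fun w => f (Y w - cy)).
    move=> /continuous_measurable_fun mf; apply: measurableT_comp mf _.
    exact: measurable_funB.
  have [mu _] := bu; have [mv _] := bv.
  have muv (f : R -> R) : continuous f ->
      measurable_fun [set: T] (fun w => expR (u w) * f (v w)).
    move=> /continuous_measurable_fun mf; apply: measurable_funM.
      exact: measurableT_comp (@measurable_expR R) mu.
    exact: measurableT_comp mf mv.
  have Emean (f : R -> R) : continuous f ->
      mean P (fun w => expR (X w - cx) * f (Y w - cy)) =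
      mean P (fun w => expR (u w) * f (v w)).
    move=> cf; apply: mean_ae_eq; [|exact: muv|].
      by apply: measurable_funM => //; exact: mtrig.
    by move: (eqX) (eqY); apply: filterS2 => w; rewrite /u /v => -> ->.
  rewrite EZ /c /s -(Emean _ (@continuous_cos R)) -(Emean _ (@continuous_sin R)).
  rewrite /cexpectation !expectation.unlock /mean.
  by congr (_ +i* _); congr fine; apply: eq_integral => w _; rewrite cexpE.
rewrite EE normc_def lecR /=.
set N := Num.sqrt _.
(* The direction of E e^W - 1 is defined only when its modulus [N] is nonzero. *)
have [->|N0] := eqVneq N 0.
  by rewrite subr_ge0 -expR0 ler_expR divr_ge0// sqr_ge0.
have N2 : (c - 1) ^+ 2 + s ^+ 2 = N ^+ 2.
  by rewrite sqr_sqrtr ?addr_ge0 ?sqr_ge0//= subr0.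
(* The unit vector in the direction of E e^W - 1 makes the left side equal to [N]. *)
have := mean_exp_centred_le d0 bu bv u0 v0 uvd (a := (c - 1) / N) (b := s / N).
rewrite -/c -/s; set B := expR _ - 1 => h.
have -> : N = (c - 1) / N * (c - 1) + s / N * s.
  by apply: (mulIf N0); rewrite -expr2 -N2; field.
by apply: h; rewrite !exprMn -mulrDl N2 exprVn mulfV// expf_neq0.
Qed.

Theorem theorem1p1 (R : realType) (disp : measure_display)
    (T : measurableType disp) (P : probability T R)
    (d : R) (Z : T -> R[i]) (hZ : complex_random_variable Z)
    (hd : (diam P Z <= d%:E)%E) :
  `|cexpectation P (fun w => cexp (Z w - cexpectation P Z)) - 1|
    <= (expR (d ^+ 2 / 8) - 1)%:C.
Proof.
rewrite normc_def lecR.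
(* Every t > d satisfies the strict hypothesis, and the bound is continuous in t, so letting t
   decrease to d gives the claim. *)
have cvg_bound : expR (t ^+ 2 / 8) - 1 @[t --> d^'+] --> expR (d ^+ 2 / 8) - 1.
  apply: cvg_at_right_filter; apply: cvgB; last exact: cvg_cst.
  apply: continuous_cvg; first exact: continuous_expR.
  by apply: cvgMl; exact: exprn_continuous.
apply: (cvgr_to_ge cvg_bound); near=> t.
have dt : d < t by near: t; exact: nbhs_right_gt.
have := @cexpectation_exp_le_of_diam_lt _ _ _ P t Z hZ.
rewrite normc_def lecR; apply; apply: le_lt_trans hd _.
by rewrite lte_fin.
Unshelve. all: by end_near. Qed.
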